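(* Let the problem $(\mathcal{P})$: minimize $f(x)$ subject to $x \in M$, $x \in Q$, be weakly Levitin-Polyak well-posed in the extended sense. Then the penalty function $F_c = f + c\varphi$ is globally exact if and only if the following three conditions hold true: 1. $F_c$ has the zero duality gap property, i.e. $\sup_{c \ge 0} \inf_{x \in Q} F_c(x) = f_*$; 2. $F_c$ is nondegenerate in the extended sense; 3. $F_c$ is uniformly locally exact at globally optimal solutions of $(\mathcal{P})$, that is, $F_c$ is locally exact at every point $x_* \in \operatorname{argmin}(\mathcal{P})$ and there exist $0 < c_* < +\infty$ and $0 < r_* < +\infty$ such that $c_*(x_* ) < c_*$ and $r_*(x_*, c_* ) \ge r_*$ for any $x_* \in \operatorname{argmin}(\mathcal{P})$.
   Context: $(X,d)$ is a metric space, $M,Q \subset X$ are nonempty, $f \colon X \to \mathbb{R}\cup\{+\infty\}$. The feasible region $\Omega = M \cap Q$ is nonempty and the optimal value $f_* = \inf_{x\in\Omega} f(x)$ is finite; $\operatorname{argmin}(\mathcal{P})$ is the set of globally optimal solutions of $(\mathcal{P})$. Notation: $\operatorname{dist}(x,V) = \inf_{y \in V} d(x,y)$, $B(x,r) = \{y \in X \mid d(x,y) \le r\}$. An infeasibility measure (penalty term) for the constraint $x \in M$ on $Q$ is a function $\varphi \colon X \to [0,+\infty]$ such that for any $x \in Q$ one has $\varphi(x)=0 \iff x \in M$; such a $\varphi$ is fixed, and $F_c(x) = f(x) + c\varphi(x)$, $x\in X$, $c \ge 0$. The penalized problem is: minimize $F_c(x)$ subject to $x \in Q$. $(\mathcal{P})$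 is weakly Levitin-Polyak well-posed in the extended sense if $\operatorname{argmin}(\mathcal{P}) \neq \emptyset$ and for any sequence $\{x_n\}\subset X$ such that $f(x_n)\to f_*$ and $\operatorname{dist}(x_n,\Omega)\to 0$ one has $\operatorname{dist}(x_n,\operatorname{argmin}(\mathcal{P}))\to 0$. $F_c$ is nondegenerate in the extended sense if there exists $c_0 \ge 0$ such that for any $c \ge c_0$ the function $F_c$ attains a global minimum on $Q$ and there exists $x(c) \in \operatorname{argmin}_{x \in Q} F_c(x)$ such that $\operatorname{dist}(x(c),\Omega) \to 0$ as $c \to \infty$. $F_c$ is globally exact if there exists $c_* \ge 0$ such that for any $c \ge c_*$ the sets of globally optimal solutions of $(\mathcal{P})$ and of the penalized problem coincide. $F_c$ is locally exact at a locally optimal solution $x_*$ of $(\mathcal{P})$ if there exists $c_* \ge 0$ such that for any $c\ge c_*$ the point $x_*$ is a locally optimal solution of the penalized problem; $c_*(x_* )$ denotes the infimum of all such $c_*$. For such a $c_*$, $r_*(x_*,c_* )$ (the radius of local exactness) is the supremum of all $r>0$ such that $F_c(x) \ge F_c(x_* )$ for all $x \in B(x_*,r)\cap Q$ and all $c \ge c_*$. *)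

(* Defs.v *)
From mathcomp Require Import all_boot all_order all_algebra.
From mathcomp Require Import all_classical all_reals all_analysis.

Set Implicit Arguments.
Unset Strict Implicit.
Unset Printing Implicit Defensive.

Import Order.TTheory GRing.Theory Num.Theory.
Import numFieldNormedType.Exports.

Local Open Scope classical_set_scope.
Local Open Scope ring_scope.
Local Open Scope ereal_scope.

(* Extended-real valued, so that the distance to the empty set is +oo. *)
Definition dist_to (R : realType) (X : metricType R) (x : X) (V : set X) :
  \bar R := ereal_inf [set (mdist x y)%:E | y in V].

(* This is the set d(x, y) <= r; the library's closed_ball is the closure of
   the open ball, which may be smaller in a general metric space. *)
Definition cball (R : realType) (X : metricType R) (x : X) (r : R) : set X :=
  [set y | (mdist x y <= r)%R].

Definition argmin (R : realType) (X : metricType R) (A : set X)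
    (g : X -> \bar R) : set X :=
  [set x | A x /\ forall y, A y -> g x <= g y].

Definition local_argmin (R : realType) (X : metricType R) (A : set X)
    (g : X -> \bar R) : set X :=
  [set x | A x /\ \forall y \near x, A y -> g x <= g y].

Definition optimal_value (R : realType) (X : metricType R) (A : set X)
    (g : X -> \bar R) : \bar R :=
  ereal_inf [set g x | x in A].

Definition infeasibility_measure (R : realType) (X : metricType R)
    (M Q : set X) (phi : X -> \bar R) : Prop :=
  (forall x, 0 <= phi x) /\ (forall x, Q x -> (phi x = 0 <-> M x)).

(* In \bar R one has 0 * +oo = 0, so penalty f phi 0 = f. *)
Definition penalty (R : realType) (X : metricType R) (f phi : X -> \bar R)
    (c : R) (x : X) : \bar R :=
  f x + c%:E * phi x.

Definition weakly_LP_well_posed_ext (R : realType) (X : metricType R)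
    (M Q : set X) (f : X -> \bar R) : Prop :=
  argmin (M `&` Q) f !=set0 /\
  forall u : nat -> X,
    f (u n) @[n --> \oo] --> optimal_value (M `&` Q) f ->
    dist_to (u n) (M `&` Q) @[n --> \oo] --> 0 ->
    dist_to (u n) (argmin (M `&` Q) f) @[n --> \oo] --> 0.

Definition globally_exact (R : realType) (X : metricType R) (M Q : set X)
    (f phi : X -> \bar R) : Prop :=
  exists2 cs : R, (0 <= cs)%R &
    forall c : R, (cs <= c)%R ->
      argmin (M `&` Q) f = argmin Q (penalty f phi c).

Definition zero_duality_gap (R : realType) (X : metricType R) (M Q : set X)
    (f phi : X -> \bar R) : Prop :=
  ereal_sup [set optimal_value Q (penalty f phi c) | c in [set c : R | (0 <= c)%R]]
  = optimal_value (M `&` Q) f.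

Definition nondegenerate_ext (R : realType) (X : metricType R) (M Q : set X)
    (f phi : X -> \bar R) : Prop :=
  exists c0 : R,
    [/\ (0 <= c0)%R,
        forall c : R, (c0 <= c)%R -> argmin Q (penalty f phi c) !=set0 &
        exists2 xc : R -> X,
          forall c : R, (c0 <= c)%R -> argmin Q (penalty f phi c) (xc c) &
          dist_to (xc c) (M `&` Q) @[c --> +oo%R] --> 0].

Definition local_exactness_bound (R : realType) (X : metricType R)
    (Q : set X) (f phi : X -> \bar R) (xs : X) (cs : R) : Prop :=
  (0 <= cs)%R /\
  forall c : R, (cs <= c)%R -> local_argmin Q (penalty f phi c) xs.

(* Meant for a point xs that is a local minimizer of f on M `&` Q. *)
Definition locally_exact_at (R : realType) (X : metricType R)
    (Q : set X) (f phi : X -> \bar R) (xs : X) : Prop :=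
  exists cs : R, local_exactness_bound Q f phi xs cs.

Definition least_local_param (R : realType) (X : metricType R)
    (Q : set X) (f phi : X -> \bar R) (xs : X) : \bar R :=
  ereal_inf [set cs%:E | cs in local_exactness_bound Q f phi xs].

Definition local_exactness_radius (R : realType) (X : metricType R)
    (Q : set X) (f phi : X -> \bar R) (xs : X) (cs : R) : \bar R :=
  ereal_sup [set r%:E | r in [set r : R | (0 < r)%R /\
    forall c : R, (cs <= c)%R -> forall x, (cball xs r `&` Q) x ->
      penalty f phi c xs <= penalty f phi c x]].

Definition uniformly_locally_exact (R : realType) (X : metricType R)
    (M Q : set X) (f phi : X -> \bar R) : Prop :=
  (forall xs, argmin (M `&` Q) f xs -> locally_exact_at Q f phi xs) /\
  exists cs rs : R,
    [/\ (0 < cs)%R, (0 < rs)%R &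
        forall xs, argmin (M `&` Q) f xs ->
          least_local_param Q f phi xs < cs%:E /\
          rs%:E <= local_exactness_radius Q f phi xs cs].

(* Main.v *)
(** The half-parameter trick: [2 F_(c/2) - F_c = f] wherever [F_c] is finite, so
    that along minimizers [x(c)] of [F_c] one has
    [2 inf_Q F_(c/2) - f_* <= f (x(c)) <= f_*], and zero duality gap forces
    [f (x(c)) --> f_*].  With nondegeneracy and well-posedness, [x(c)] gets
    within the uniform radius of local exactness of some optimal solution, which
    makes [inf_Q F_c = f_*] for one [c].  For every larger parameter a minimizer
    of the penalty function must have [phi = 0]. *)
Require Import Defs.
From mathcomp Require Import all_boot all_order all_algebra.
From mathcomp Require Import all_classical all_reals all_analysis.
From mathcomp Require Import lra.

Set Implicit Arguments.
Unset Strict Implicit.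
Unset Printing Implicit Defensive.

Import Order.TTheory GRing.Theory Num.Theory.
Import numFieldNormedType.Exports.

Local Open Scope classical_set_scope.
Local Open Scope ereal_scope.

Section OptimalValue.
Context {R : realType} {X : metricType R}.
Implicit Types (A : set X) (g h : X -> \bar R) (x : X).

Lemma optimal_value_le A g x : A x -> optimal_value A g <= g x.
Proof. by move=> Ax; apply: ereal_inf_lbound; exists x. Qed.

Lemma argmin_optimal_value A g x : argmin A g x -> optimal_value A g = g x.
Proof.
move=> [Ax gx]; apply/eqP; rewrite eq_le optimal_value_le //=.
by apply: le_ereal_inf_tmp => _ [y Ay <-]; exact: gx.
Qed.

Lemma argmin_le_optimal_value A g x :
  A x -> g x <= optimal_value A g -> argmin A g x.
Proof.
by move=> Ax gx; split=> // y Ay; apply: le_trans gx (optimal_value_le _ Ay).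
Qed.

Lemma optimal_value_mono A g h :
  (forall x, g x <= h x) -> optimal_value A g <= optimal_value A h.
Proof.
move=> gh; apply: le_ereal_inf_tmp => _ [x Ax <-].
exact: le_trans (optimal_value_le _ Ax) (gh x).
Qed.

Lemma dist_to_mem A x : A x -> dist_to x A = 0.
Proof.
move=> Ax; apply/eqP; rewrite eq_le; apply/andP; split.
  by apply: ereal_inf_lbound; exists x => //; rewrite mdistxx.
by apply: le_ereal_inf_tmp => _ [y _ <-]; rewrite lee_fin mdist_ge0.
Qed.

Lemma argmin_local_argmin A g x : argmin A g x -> local_argmin A g x.
Proof. by move=> [Ax gx]; split=> //; apply: nearW => y; exact: gx. Qed.

End OptimalValue.

Section Penalty.
Context {R : realType} {X : metricType R} {M Q : set X} {f phi : X -> \bar R}.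
Hypothesis phi_infeas : infeasibility_measure M Q phi.
Hypothesis f_neqNy : forall x, f x != -oo.
Implicit Types (c d s : R) (x : X).

Let phi_ge0 x : 0 <= phi x. Proof. by case: phi_infeas => + _; apply. Qed.

Lemma penalty_feasible c x : (M `&` Q) x -> penalty f phi c x = f x.
Proof.
by move=> [Mx Qx]; rewrite /penalty (phi_infeas.2 x Qx).2 // mule0 adde0.
Qed.

Lemma penalty_mono c d x : (c <= d)%R -> penalty f phi c x <= penalty f phi d x.
Proof. by move=> cd; rewrite leeD2l// lee_wpmul2r// lee_fin. Qed.

(** Weak duality: on feasible points the penalty term vanishes, and they all lie in [Q]. *)
Lemma penalty_optimal_value_le c :
  optimal_value Q (penalty f phi c) <= optimal_value (M `&` Q) f.
Proof.
apply: le_ereal_inf_tmp => _ [x Ox <-].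
by rewrite -(penalty_feasible c Ox); apply: optimal_value_le; case: Ox.
Qed.

(** Passage to real arithmetic: an infinite [f x] or [phi x] would make the sum [+oo]. Positivity of
    [c] matters because [0 * +oo = 0]. *)
Lemma penalty_fin c x s : (0 < c)%R -> penalty f phi c x <= s%:E ->
  exists a p, [/\ f x = a%:E, phi x = p%:E, (0 <= p)%R & (a + c * p <= s)%R].
Proof.
move=> c0; have := f_neqNy x; have := phi_ge0 x; rewrite /penalty.
case: (f x) => [a||] //; case: (phi x) => [p||] // p0 _.
  by rewrite -EFinM -EFinD lee_fin => ?; exists a, p; split.
all: by rewrite ?gt0_muley ?lte_fin.
Qed.

(* The parameter has to increase strictly: at [c] itself, infeasible points may
   still be minimizers. *)
Lemma globally_exact_of_optimal_value c :
  argmin (M `&` Q) f !=set0 -> optimal_value (M `&` Q) f \is a fin_num ->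
  (0 <= c)%R ->
  optimal_value Q (penalty f phi c) = optimal_value (M `&` Q) f ->
  globally_exact M Q f phi.
Proof.
move=> [x0 x0min] /fineK; set s := fine _ => sE c0 vc.
exists (c + 1)%R => [|d cd]; first by rewrite addr_ge0.
(* The penalized values are nondecreasing in the parameter and capped by weak duality, so once they
   reach the optimal value they stay there. *)
have vd : optimal_value Q (penalty f phi d) = optimal_value (M `&` Q) f.
  apply/eqP; rewrite eq_le penalty_optimal_value_le /= -vc.
  by apply: optimal_value_mono => x; apply: penalty_mono; lra.
apply/seteqP; split=> x xmin.
  have Ox := xmin.1; apply: argmin_le_optimal_value; first by case: Ox.
  by rewrite penalty_feasible// vd (argmin_optimal_value xmin).
have Qx := xmin.1; have := argmin_optimal_value xmin; rewrite vd -sE => Fd.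
have d_gt0 : (0 < d)%R by lra.
have [|a [p [fx px p0 ap]]] := @penalty_fin d x s d_gt0; first by rewrite -Fd.
have : s%:E <= penalty f phi c x by rewrite sE -vc; exact: optimal_value_le.
rewrite /penalty fx px -EFinM -EFinD lee_fin => sle.
(* Chaining [a + d * p <= s <= a + c * p] gives [(d - c) * p <= 0], while [d - c >= 1]. *)
have p_eq0 : p = 0%R by apply/eqP; rewrite eq_le p0 andbT; nra.
have Ox : (M `&` Q) x.
  by split=> //; apply: (phi_infeas.2 x Qx).1; rewrite px p_eq0.
apply: argmin_le_optimal_value => //.
by rewrite fx -sE lee_fin; move: ap; rewrite p_eq0; lra.
Qed.

Lemma argmin_penalty_cvg (xc : R -> X) c0 :
  optimal_value (M `&` Q) f \is a fin_num ->
  zero_duality_gap M Q f phi ->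
  (forall c, (c0 <= c)%R -> argmin Q (penalty f phi c) (xc c)) ->
  f (xc c) @[c --> +oo%R] --> optimal_value (M `&` Q) f.
Proof.
move=> /fineK; set s := fine _ => sE gap xcmin.
have bnd c : (c0 <= c)%R -> (0 < c)%R -> exists a p,
    [/\ f (xc c) = a%:E, phi (xc c) = p%:E, (0 <= p)%R & (a + c * p <= s)%R].
  move=> c0c cgt0; apply: penalty_fin => //.
  by rewrite -(argmin_optimal_value (xcmin c c0c)) sE penalty_optimal_value_le.
rewrite -sE; apply/fine_cvgP; split.
  near=> c.
  have c0c : (c0 <= c)%R by near: c; apply: nbhs_pinfty_ge; exact: num_real.
  have cgt0 : (0 < c)%R by near: c; apply: nbhs_pinfty_gt; exact: num_real.
  by have [a [p [-> _ _ _]]] := bnd c c0c cgt0.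
apply/cvgrPdist_le => e e0.
(* The margin is [e / 2] because the lower bound on the penalty at [c / 2] gets doubled below. *)
have : (s - e / 2)%:E < optimal_value (M `&` Q) f by rewrite -sE lte_fin; lra.
rewrite -gap => /ereal_sup_gt[_ [C /= C0 <-]] vC.
near=> c; rewrite /=.
have c0c : (c0 <= c)%R by near: c; apply: nbhs_pinfty_ge; exact: num_real.
have cgt0 : (0 < c)%R by near: c; apply: nbhs_pinfty_gt; exact: num_real.
have Cc : (C <= c / 2)%R.
  by rewrite ler_pdivlMr//; near: c; apply: nbhs_pinfty_ge; exact: num_real.
have [a [p [fx px p0 ap]]] := bnd c c0c cgt0.
have : (s - e / 2)%:E < penalty f phi (c / 2) (xc c).
  apply: lt_le_trans vC _; apply: le_trans (penalty_mono _ Cc).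
  by apply: optimal_value_le; exact: (xcmin c c0c).1.
rewrite /penalty fx px -EFinM -EFinD lte_fin /= => lb.
(* Upper bound: [a <= a + c * p <= s]. Lower bound: [a = 2 * (a + c / 2 * p) - (a + c * p) > 2 * (s
   - e / 2) - s = s - e]. *)
by rewrite ler_norml; apply/andP; split; nra.
Unshelve. all: by end_near. Qed.

End Penalty.

(** Past the exactness threshold, every optimal solution minimizes the penalty function on all of
    [Q]. Hence one fixed solution [x0] closes the duality gap and serves as a constant trajectory
    [xc], and local exactness holds on balls of any radius. *)
Lemma globally_exact_necessary (R : realType) (X : metricType R) (M Q : set X)
    (f phi : X -> \bar R) :
  infeasibility_measure M Q phi -> argmin (M `&` Q) f !=set0 ->
  globally_exact M Q f phi ->
  [/\ zero_duality_gap M Q f phi, nondegenerate_ext M Q f phi &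
      uniformly_locally_exact M Q f phi].
Proof.
move=> phi_infeas [x0 x0min] [cs cs0 exact_cs].
have minQ x c : argmin (M `&` Q) f x -> (cs <= c)%R ->
    argmin Q (penalty f phi c) x by move=> + /exact_cs <-.
split.
- apply/eqP; rewrite eq_le; apply/andP; split.
    apply: ge_ereal_sup => _ [c _ <-].
    exact: penalty_optimal_value_le.
  apply: ereal_sup_ubound; exists cs => //.
  rewrite (argmin_optimal_value (minQ _ _ x0min (lexx _))).
  by rewrite (argmin_optimal_value x0min) (penalty_feasible phi_infeas)//; case: x0min.
- exists cs; split=> // [c csc|]; first by exists x0; exact: minQ.
  exists (fun=> x0) => [c|]; first exact: minQ.
  by rewrite dist_to_mem; [exact: cvg_cst | case: x0min].
- have bound x : argmin (M `&` Q) f x -> local_exactness_bound Q f phi x cs.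
    by move=> xmin; split=> // c csc; apply/argmin_local_argmin/minQ.
  split=> [x /bound ?|]; first by exists cs.
  (* Adding [1] makes the parameter positive and strictly larger than the least local one; the
     radius [1] is arbitrary. *)
  exists (cs + 1)%R, 1%R; split=> [|//|x xmin]; first by lra.
  split.
    apply: (@le_lt_trans _ _ cs%:E); last by rewrite lte_fin; lra.
    by apply: ereal_inf_lbound; exists cs => //; exact: bound.
  apply: ereal_sup_ubound; exists 1%R => //; split=> // c csc y [_ Qy].
  by apply: (minQ x c xmin _).2 => //; lra.
Qed.

Lemma globally_exact_sufficient (R : realType) (X : metricType R)
    (M Q : set X) (f phi : X -> \bar R) :
  (forall x, f x != -oo) -> optimal_value (M `&` Q) f \is a fin_num ->
  infeasibility_measure M Q phi -> weakly_LP_well_posed_ext M Q f ->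
  zero_duality_gap M Q f phi -> nondegenerate_ext M Q f phi ->
  uniformly_locally_exact M Q f phi -> globally_exact M Q f phi.
Proof.
move=> f_neqNy fstar_fin phi_infeas [argmin_neq0 wp] gap.
move=> [c0 [c0_ge0 _ [xc xcmin xcO]]] [_ [cs [rs [cs0 rs0 unif]]]].
have xcf := argmin_penalty_cvg phi_infeas f_neqNy fstar_fin gap xcmin.
(* Well-posedness speaks of sequences, so the trajectory is sampled at integer parameters. *)
have := wp (fun n => xc n%:R%R) (cvg_comp _ _ cvgr_idn xcf)
  (cvg_comp _ _ cvgr_idn xcO).
move=> /fine_cvgP[dfin /cvgrPdist_lt /(_ _ rs0) dlt].
near \oo%classic => n.
have nc0 : (c0 <= n%:R)%R by near: n; exact: nbhs_infty_ger.
have ncs : (cs <= n%:R)%R by near: n; exact: nbhs_infty_ger.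
have dn : dist_to (xc n%:R%R) (argmin (M `&` Q) f) < rs%:E.
  have dnf : dist_to (xc n%:R%R) (argmin (M `&` Q) f) \is a fin_num by near: n.
  rewrite -(fineK dnf) lte_fin.
  apply: (@le_lt_trans _ _ `|0 - fine (dist_to (xc n%:R) (argmin (M `&` Q) f))|%R).
    by rewrite sub0r normrN ler_norm.
  by near: n.
have [_ [x xmin <-] dx] := ereal_inf_lt dn.
have [_ rx] := unif x xmin.
(* The radius of exactness is a supremum that may not be attained; the strict bound on the distance
   still yields an admissible [r] whose ball around [x] contains the minimizer. *)
have [_ [r [r0 rball] <-] dr] := ereal_sup_gt (lt_le_trans dx rx).
apply: (globally_exact_of_optimal_value phi_infeas f_neqNy (c := n%:R%R)) => //.
(* It remains to bound the penalized minimum below by [f x], that is, by the penalty function at the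
   feasible point [x]; this is local exactness at [x]. *)
apply/eqP; rewrite eq_le penalty_optimal_value_le//=.
rewrite (argmin_optimal_value (xcmin _ nc0)) (argmin_optimal_value xmin).
rewrite -(penalty_feasible (f := f) phi_infeas n%:R%R xmin.1).
apply: rball => //; split; last exact: (xcmin _ nc0).1.
by rewrite /cball /= metric_sym ltW // -lte_fin.
Unshelve. all: by end_near. Qed.

Theorem theorem5 (R : realType) (X : metricType R) (M Q : set X)
    (f phi : X -> \bar R)
    (M_neq0 : M !=set0) (Q_neq0 : Q !=set0) (Omega_neq0 : M `&` Q !=set0)
    (f_neqNy : forall x, f x != -oo)
    (fstar_fin : optimal_value (M `&` Q) f \is a fin_num)
    (phi_infeas : infeasibility_measure M Q phi)
    (f_wp : weakly_LP_well_posed_ext M Q f) :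
  globally_exact M Q f phi <->
  [/\ zero_duality_gap M Q f phi,
      nondegenerate_ext M Q f phi &
      uniformly_locally_exact M Q f phi].
Proof.
split; first by apply: globally_exact_necessary => //; case: f_wp.
by case; exact: globally_exact_sufficient.
Qed.
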